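(* Let $tr>s\ge r\ge 2$ and $t\ge 1$ be arbitrary integers and let $x=\left\lceil \frac{tr-s}{t-1}\right\rceil-1$. Let $\mathcal T$ be a $K_{x+1}^p$-free $p$-graph on $n-t(r-x)+1$ vertices with the most copies of $K_x^p$. Then $$\mathrm{ex}(n,K_s^p,tK_r^p)=(1+o(1))\,\mathcal N\bigl(K_s^p,\;K_{t(r-x)-1}^p+\mathcal T\bigr).$$ In particular, $\mathrm{ex}(n,K_s^p,tK_r^p)=\Theta(n^x)$.
   Context: A $p$-graph is a $p$-uniform hypergraph. $K_r^p$ is the complete $p$-uniform hypergraph on $r$ vertices, and $tK_r^p$ is the vertex-disjoint union of $t$ copies of $K_r^p$. A $p$-graph is $F$-free if it contains no copy of $F$ as a subhypergraph. $\mathcal N(H,G)$ is the number of copies of $H$ in $G$. $\mathrm{ex}(n,H,F)$ is the largest value of $\mathcal N(H,G)$ over all $F$-free $n$-vertex $p$-graphs $G$. For two $p$-graphs $\mathcal H$ and $\mathcal H'$ with disjoint vertex sets, $\mathcal H+\mathcal H'$ is the $p$-graph on the union of the two vertex sets that contains $\mathcal H$ and $\mathcal H'$ and, as additional hyperedges, all the $p$-sets of vertices intersecting both $V(\mathcal H)$ and $V(\mathcal H')$. The asymptotic notation is as $n\to\infty$ with $p,r,s,t$ fixed. *)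

(* Defs.v *)
From HB Require Import structures.
From mathcomp Require Import all_boot.

Set Implicit Arguments.
Unset Strict Implicit.
Unset Printing Implicit Defensive.

Definition p_uniform (p : nat) (V : finType) (E : {set {set V}}) : bool :=
  [forall e in E, #|e| == p].

Record pgraph (p : nat) (V : finType) := PGraph {
  hedges :> {set {set V}};
  _ : p_uniform p hedges }.

HB.instance Definition _ p V := [isSub for @hedges p V].
HB.instance Definition _ p V := [Finite of @pgraph p V by <:].

Lemma hedges_card p V (G : pgraph p V) (e : {set V}) : e \in hedges G -> #|e| = p.
Proof. by case: G => E /= /forall_inP uE /uE /eqP. Qed.

Section Copies.
Variables (p : nat) (W V : finType).

Definition is_embedding (H : pgraph p W) (G : pgraph p V) (f : {ffun W -> V}) :=
  injectiveb f && [forall e in hedges H, f @: e \in hedges G].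

(* A copy of H in G is a (not necessarily induced) subhypergraph of G isomorphic
   to H, given by its vertex set and its edge set: embeddings of H that differ
   by an automorphism of H give the same copy. *)
Definition copies (H : pgraph p W) (G : pgraph p V)
    : {set {set V} * {set {set V}}} :=
  [set (f @: [set: W], [set f @: (e : {set W}) | e in hedges H])
     | f : {ffun W -> V} & is_embedding H G f].

Definition ncopies (H : pgraph p W) (G : pgraph p V) : nat := #|copies H G|.

Definition hfree (F : pgraph p W) (G : pgraph p V) : bool := copies F G == set0.

End Copies.

(* The maximum over an empty set of F-free p-graphs is 0. *)
Definition hex (p n : nat) (W U : finType) (H : pgraph p W) (F : pgraph p U) : nat :=
  \max_(G : pgraph p 'I_n | hfree F G) ncopies H G.

Definition is_extremal (p : nat) (V W U : finType) (H : pgraph p W)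
    (F : pgraph p U) (G : pgraph p V) : Prop :=
  hfree F G /\ forall G' : pgraph p V, hfree F G' -> ncopies H G' <= ncopies H G.

Definition complete_edges (p : nat) (V : finType) : {set {set V}} :=
  [set e : {set V} | #|e| == p].

Lemma complete_uniform p V : p_uniform p (complete_edges p V).
Proof. by apply/forall_inP => e; rewrite inE. Qed.

Definition complete_pgraph (p r : nat) : pgraph p 'I_r :=
  PGraph (complete_uniform p 'I_r).

Section Copower.
Variables (p t : nat) (V : finType) (H : pgraph p V).

Definition disjoint_copies_edges : {set {set 'I_t * V}} :=
  [set pair i @: (e : {set V}) | i in 'I_t, e in hedges H].

Lemma disjoint_copies_uniform : p_uniform p disjoint_copies_edges.
Proof.
apply/forall_inP => _ /imset2P[i e _ He ->].
by rewrite card_imset ?(hedges_card He) // => x y [].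
Qed.

Definition disjoint_copies : pgraph p ('I_t * V)%type :=
  PGraph disjoint_copies_uniform.

End Copower.

Section Join.
Variables (p : nat) (V1 V2 : finType) (H1 : pgraph p V1) (H2 : pgraph p V2).

Definition join_edges : {set {set V1 + V2}} :=
  [set inl @: (e : {set V1}) | e in hedges H1]
  :|: [set inr @: (e : {set V2}) | e in hedges H2]
  :|: [set e : {set V1 + V2} |
        [&& #|e| == p, [exists v, inl v \in e] & [exists v, inr v \in e]]].

Lemma join_uniform : p_uniform p join_edges.
Proof.
apply/forall_inP => e; rewrite !inE => /orP[/orP[]/imsetP[e' He' ->]|].
- by rewrite card_imset ?(hedges_card He') // => x y [].
- by rewrite card_imset ?(hedges_card He') // => x y [].
- by case/and3P.
Qed.

Definition hjoin : pgraph p (V1 + V2)%type := PGraph join_uniform.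

End Join.

(* Main.v *)
(** Write k = r - x, q = s - x and l = t k - 1; the hypotheses amount to
    (k - 1) t < q < t k.

    Upper bound.  Let G be tK_r-free.  A sunflower of t copies of K_s whose
    kernel has fewer than q vertices contains t disjoint copies of K_r, so a
    set A of bounded size meets every copy of K_s in at least q vertices.
    Hence there are O(n^x) copies, and all but O(n^(x-1)) of them consist of a
    q-set S in A and x vertices outside A, where S is moreover rich: no
    bounded set meets all the x-sets extending S to a copy of K_s.  If the rich
    sets covered t k vertices, one could pack t disjoint k-sets into them and
    complete these to t disjoint copies of K_r; so the rich sets live on l
    vertices and there are at most C(l, q) of them.  The x-sets extending a
    given S are cliques of the link of S outside A, and this link is
    K_{x+1}-free, since an (x+1)-clique in it would give a copy of K_s
    with only q - 1 vertices in A.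

    Lower bound.  K_l + T is tK_r-free, because every copy of K_r has at least
    k vertices in K_l, and it has at least C(l, q) N(K_x, T) copies of K_s.

    For x + 1 < p no large p-graph is K_{x+1}-free, so the first claim is then
    vacuous; the order of magnitude n^x is reached by a p-graph which is
    x-partite outside l vertices. *)

Require Import Defs.
From mathcomp Require Import all_boot all_order all_algebra.
From mathcomp Require Import classical_sets functions reals topology normedtype sequences landau.
From mathcomp Require Import fintype finset bigop zify lra.
Import Order.TTheory GRing.Theory Num.Theory numFieldNormedType.Exports.

(** * Families of disjoint sets *)

Lemma disjoint_notinP {V : finType} {A B : {set V}} :
  reflect (forall v, v \in A -> v \notin B) [disjoint A & B].
Proof.
apply: (iffP idP) => [dAB v vA|h]; first by rewrite (disjointFr dAB vA).
by rewrite disjoints_subset; apply/subsetP => v /h; rewrite inE.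
Qed.

Lemma exists_subset_between (V : finType) (B Y : {set V}) (k : nat) :
  B \subset Y -> #|B| <= k <= #|Y| ->
  exists e : {set V}, [/\ B \subset e, e \subset Y & #|e| = k].
Proof.
elim: k => [|k IH] sBY /andP[hB hY].
  by exists B; split=> //; apply/eqP; rewrite -leqn0.
move: hB; rewrite leq_eqVlt => /orP[/eqP hB|hB]; first by exists B.
have [|e [sBe seY ce]] := IH sBY; first by rewrite -ltnS hB ltnW.
have /subsetPn[v vY ve] : ~~ (Y \subset e).
  by apply: contraTN hY => /subset_leq_card; rewrite ce -leqNgt.
exists (v |: e); split; last by rewrite cardsU1 ve ce.
  exact: subset_trans sBe (subsetUr _ _).
by rewrite subUset sub1set vY.
Qed.

Lemma exists_subset_card (V : finType) (Y : {set V}) (k : nat) :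
  k <= #|Y| -> exists2 e : {set V}, e \subset Y & #|e| = k.
Proof.
move=> kY; have [|e [_ seY ce]] := @exists_subset_between V set0 Y k (sub0set _).
  by rewrite cards0.
by exists e.
Qed.

Definition pairwise_disjoint (V : finType) (t : nat) (f : nat -> {set V}) : Prop :=
  forall i j, i < t -> j < t -> i != j -> [disjoint f i & f j].

Lemma pairwise_disjoint_sub {V : finType} {t : nat} {f g : nat -> {set V}} :
  pairwise_disjoint V t f -> (forall i, i < t -> g i \subset f i) ->
  pairwise_disjoint V t g.
Proof.
by move=> df sgf i j it jt nij; apply: disjointW (sgf _ it) (sgf _ jt) (df _ _ it jt nij).
Qed.

(** The sets are chosen one after another; those already chosen cover at most [t * c] vertices, so
    their union may serve as [Z]. *)
Lemma greedy_transversal (V : finType) (t c : nat) (F : nat -> {set V} -> Prop) :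
  (forall i X, i < t -> F i X -> #|X| <= c) ->
  (forall i (Z : {set V}), i < t -> #|Z| <= t * c ->
     exists2 X, F i X & [disjoint X & Z]) ->
  exists2 f : nat -> {set V},
    (forall i, i < t -> F i (f i)) & pairwise_disjoint V t f.
Proof.
move=> Fc hF.
suff: forall k, k <= t -> exists f : nat -> {set V},
  [/\ forall i, i < k -> F i (f i), pairwise_disjoint V k f
    & #|\bigcup_(i < k) f i| <= k * c].
  by move=> /(_ t (leqnn t)) [f [Ff df _]]; exists f.
elim=> [|k IH] kt; first by exists (fun=> set0); split=> //; rewrite big_ord0 cards0.
have [f [Ff df cf]] := IH (ltnW kt).
have [|X FX dX] := hF k (\bigcup_(i < k) f i) kt.
  by apply: leq_trans cf _; rewrite leq_mul2r ltnW ?orbT.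
have dXi i : i < k -> [disjoint X & f i].
  by move=> ik; apply: disjointWr dX; apply: (bigcup_sup (Ordinal ik)).
exists (fun i => if i == k then X else f i); split.
- move=> i; case: eqP => [->//|/eqP nik] ik; apply: Ff.
  by rewrite ltn_neqAle nik -ltnS.
- move=> i j ik jk nij.
  case: (eqVneq i k) => [ei|ni]; case: (eqVneq j k) => [ej|nj].
  + by rewrite ei ej eqxx in nij.
  + by apply: dXi; lia.
  + by rewrite disjoint_sym; apply: dXi; lia.
  + by apply: df; lia.
- rewrite big_ord_recr /= eqxx mulSn addnC.
  apply: leq_trans (leq_card_setU _ _) _; apply: leq_add; last exact: Fc FX.
  rewrite (eq_bigr (fun i : 'I_k => f i)) // => i _.
  by rewrite ltn_eqF.
Qed.

Lemma card_bigcup_cond_leq (V I : finType) (P : pred I) (c : nat) (F : I -> {set V}) :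
  (forall i, P i -> #|F i| <= c) -> #|\bigcup_(i | P i) F i| <= #|P| * c.
Proof.
move=> hF; rewrite -sum_nat_const.
elim/big_rec2: _ => [|i m A Pi hA]; first by rewrite cards0.
by apply: leq_trans (leq_card_setU _ _) _; apply: leq_add (hF i Pi) hA.
Qed.

Lemma card_bigcup_leq (V : finType) (t c : nat) (f : nat -> {set V}) :
  (forall i, i < t -> #|f i| <= c) -> #|\bigcup_(i < t) f i| <= t * c.
Proof.
by move=> hf; rewrite -[t in t * _]card_ord; apply: card_bigcup_cond_leq => i _; apply: hf.
Qed.

Lemma bigcup_notinP {V : finType} {t : nat} {f : nat -> {set V}} {v : V} :
  v \notin \bigcup_(i < t) f i <-> forall i, i < t -> v \notin f i.
Proof.
split=> [h i it|h]; first by apply: contra h => vf; apply/bigcupP; exists (Ordinal it).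
by apply/negP => /bigcupP[i _]; apply/negP; apply: h.
Qed.

Lemma card_bigcup_disjoint (V : finType) (t : nat) (f : nat -> {set V}) :
  pairwise_disjoint V t f -> #|\bigcup_(i < t) f i| = \sum_(i < t) #|f i|.
Proof.
elim: t => [|t IH] df; first by rewrite !big_ord0 cards0.
rewrite !big_ord_recr /= -IH; last by move=> i j it jt; apply: df; apply: ltnW.
apply/eqP; rewrite (leq_card_setU _ _).2 disjoint_sym; apply/disjoint_notinP => v vt.
apply/bigcup_notinP => i it.
by rewrite (disjointFr (df t i (ltnSn t) (ltnW it) _) vt) // gtn_eqF.
Qed.

Lemma pairwise_disjoint_cat (V : finType) (a b : nat) (f g : nat -> {set V}) :
  pairwise_disjoint V a f -> pairwise_disjoint V b g ->
  (forall i j, i < a -> j < b -> [disjoint f i & g j]) ->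
  pairwise_disjoint V (a + b) (fun i => if i < a then f i else g (i - a)).
Proof.
move=> df dg dfg i j ia ja nij.
case: ltnP => hi; case: ltnP => hj.
- exact: df.
- by apply: dfg => //; lia.
- by rewrite disjoint_sym; apply: dfg => //; lia.
- by apply: dg; lia.
Qed.

Lemma split_disjoint (V : finType) (t c : nat) (J : {set V}) :
  t * c <= #|J| ->
  exists2 f : nat -> {set V}, (forall i, i < t -> f i \subset J /\ #|f i| = c)
    & pairwise_disjoint V t f.
Proof.
move=> hJ.
suff: forall k, k <= t -> exists2 f : nat -> {set V},
  (forall i, i < k -> f i \subset J /\ #|f i| = c) & pairwise_disjoint V k f.
  by apply.
elim=> [|k IH] kt; first by exists (fun=> set0).
have [f Ff df] := IH (ltnW kt).
have cU : #|\bigcup_(i < k) f i| <= k * c.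
  by apply: card_bigcup_leq => i /Ff[_ ->].
have [|X sX cX] := @exists_subset_card V (J :\: \bigcup_(i < k) f i) c.
  rewrite cardsD leq_subRL.
    apply: leq_trans hJ; apply: leq_trans (_ : k.+1 * c <= _); last by rewrite leq_mul2r kt orbT.
    rewrite mulSn addnC leq_add2l; apply: leq_trans cU; exact: subset_leq_card (subsetIr _ _).
  by apply: subset_leq_card; apply: subsetIl.
exists (fun i => if i < k then f i else X) => [i|].
  rewrite ltnS => ik; case: ltnP => [/Ff//|_]; split=> //.
  by apply: subset_trans sX (subsetDl _ _).
have := @pairwise_disjoint_cat V k 1 f (fun=> X) df.
rewrite addn1; apply; first by move=> i j; lia.
move=> i j ik _; rewrite disjoint_sym; apply: disjointWl sX _.
rewrite -setI_eq0; apply/eqP/setP => v; rewrite !inE.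
case vf: (v \in f i); rewrite ?andbF // andbT.
by rewrite (_ : v \in _) //; apply/bigcupP; exists (Ordinal ik).
Qed.

(** * Cliques and copies *)

(** A set with fewer than [p] vertices is vacuously a clique, just as [K_k^p] has no edges for
    [k < p]. *)
Definition clique {p : nat} {V : finType} (G : pgraph p V) (Q : {set V}) : bool :=
  [forall e : {set V}, (e \subset Q) && (#|e| == p) ==> (e \in hedges G)].

Definition cliques {p : nat} {V : finType} (k : nat) (G : pgraph p V) : {set {set V}} :=
  [set Q : {set V} | (#|Q| == k) && clique G Q].

Lemma cliqueP {p : nat} {V : finType} {G : pgraph p V} {Q : {set V}} :
  reflect (forall e : {set V}, e \subset Q -> #|e| = p -> e \in hedges G) (clique G Q).
Proof.
apply: (iffP forallP) => [h e seQ ce|h e].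
  by have := h e; rewrite seQ ce eqxx.
by apply/implyP => /andP[seQ /eqP ce]; apply: h.
Qed.

Lemma cliqueS {p : nat} {V : finType} {G : pgraph p V} {Q Q' : {set V}} :
  Q' \subset Q -> clique G Q -> clique G Q'.
Proof.
move=> sQ /cliqueP cQ; apply/cliqueP => e se; apply: cQ; exact: subset_trans sQ.
Qed.

Lemma cliquesP {p : nat} {V : finType} {k : nat} {G : pgraph p V} {Q : {set V}} :
  reflect (#|Q| = k /\ clique G Q) (Q \in cliques k G).
Proof. by rewrite inE; apply: (iffP andP) => -[/eqP]. Qed.

Lemma ex_inj_onto {V : finType} {r : nat} {Q : {set V}} :
  #|Q| = r -> exists2 g : {ffun 'I_r -> V}, injective g & g @: [set: 'I_r] = Q.
Proof.
move=> <-; exists [ffun i => enum_val i].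
  by move=> i j; rewrite !ffunE; apply: enum_val_inj.
apply/setP => v; apply/imsetP/idP => [[i _ ->]|vQ].
  by rewrite ffunE; apply: enum_valP.
by exists (enum_rank_in vQ v) => //; rewrite ffunE enum_rankK_in.
Qed.

Lemma preimset_imset {V W : finType} (f : W -> V) (e : {set V}) (A : {set W}) :
  e \subset f @: A -> f @: (A :&: f @^-1: e) = e.
Proof.
move=> /subsetP se; apply/setP => v; apply/imsetP/idP.
  by move=> [w]; rewrite !inE => /andP[_ hw] ->.
move=> ve; have /imsetP[w wA ew] := se v ve.
by exists w => //; rewrite !inE wA -ew.
Qed.

(** A copy of a complete graph is determined by its vertex set, because its edges are all the
    [p]-subsets of that set. *)
Lemma ncopies_complete (p k : nat) (V : finType) (G : pgraph p V) :
  ncopies (complete_pgraph p k) G = #|cliques k G|.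
Proof.
have inj : injective (fun Q : {set V} => (Q, [set e : {set V} | (e \subset Q) && (#|e| == p)])).
  by move=> Q Q' [].
rewrite -(card_imset _ inj) /ncopies /copies.
have im (f : {ffun 'I_k -> V}) : injective f ->
  [set f @: (e : {set 'I_k}) | e in hedges (complete_pgraph p k)]
    = [set e : {set V} | (e \subset f @: [set: 'I_k]) && (#|e| == p)].
  move=> fI; apply/setP => e; rewrite inE; apply/imsetP/andP.
    move=> [e']; rewrite inE => ce' ->; rewrite card_imset //; split=> //.
    by apply: imsetS; apply: subsetT.
  move=> [se ce]; exists ([set: 'I_k] :&: f @^-1: e).
    by rewrite inE -(card_imset _ fI) preimset_imset.
  by rewrite preimset_imset.
congr #|pred_of_set _|; apply/setP => -[Q E]; apply/imsetP/imsetP.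
  move=> [f]; rewrite inE => /andP[/injectiveP fI /forall_inP fE] ->.
  exists (f @: [set: 'I_k]); last by rewrite im.
  rewrite inE card_imset // cardsT card_ord eqxx; apply/cliqueP => e se ce.
  rewrite -(preimset_imset _ _ _ se); apply: fE.
  by rewrite inE -(card_imset _ fI) preimset_imset // ce.
move=> [Q' /cliquesP[cQ /cliqueP kQ] ->].
have [f fI fQ] := ex_inj_onto cQ.
exists f; last by rewrite im // fQ.
rewrite inE; apply/andP; split; first exact/injectiveP.
apply/forall_inP => e; rewrite inE => /eqP ce.
by apply: kQ; [rewrite -fQ; apply: imsetS; apply: subsetT | rewrite card_imset].
Qed.

Lemma hfree_complete (p k : nat) (V : finType) (G : pgraph p V) :
  hfree (complete_pgraph p k) G = (cliques k G == set0).
Proof. by rewrite /hfree -!cards_eq0 -ncopies_complete. Qed.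

(** An embedding of [tK_r^p], curried, is a family of [t] injections whose images are pairwise
    disjoint cliques. *)
Lemma hfree_disjoint_copiesP {p r t : nat} {V : finType} (G : pgraph p V) :
  0 < r ->
  hfree (disjoint_copies t (complete_pgraph p r)) G <->
  ~ exists2 f : nat -> {set V},
      (forall i, i < t -> f i \in cliques r G) & pairwise_disjoint V t f.
Proof.
move=> r0; split.
  move=> /eqP h0 [f fQ df].
  have /fin_all_exists2[g gI gf] (i : 'I_t) : exists2 g : {ffun 'I_r -> V},
      injective g & g @: [set: 'I_r] = f i.
    by have /cliquesP[cf _] := fQ i (ltn_ord i); apply: ex_inj_onto.
  pose F : {ffun 'I_t * 'I_r -> V} := [ffun u => g u.1 u.2].
  have gin (i : 'I_t) j : g i j \in f i by rewrite -gf imset_f.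
  have FI : injective F.
    move=> [i j] [i' j']; rewrite !ffunE /= => e.
    have ii : i = i'.
      apply/eqP/negPn/negP => ni.
      have /disjoint_notinP/(_ _ (gin i j)) := df i i' (ltn_ord i) (ltn_ord i') ni.
      by rewrite e gin.
    by subst i'; congr pair; apply: gI e.
  have : (F @: [set: _], [set F @: (e : {set _}) | e in
       hedges (disjoint_copies t (complete_pgraph p r))])
     \in copies (disjoint_copies t (complete_pgraph p r)) G.
    apply: imset_f; rewrite inE; apply/andP; split; first exact/injectiveP.
    apply/forall_inP => _ /imset2P[i e _ he ->].
    have /cliquesP[_ /cliqueP hc] := fQ i (ltn_ord i).
    move: he; rewrite inE => /eqP ce.
    apply: hc; last first.
      by rewrite card_imset // card_imset // => a b [].
    apply/subsetP => _ /imsetP[_ /imsetP[j je ->] ->].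
    by rewrite ffunE; apply: gin.
  by rewrite h0 inE.
move=> hf; apply/negPn/negP => /set0Pn[u /imsetP[F]].
rewrite inE => /andP[/injectiveP FI /forall_inP FE] _ {u}; apply: hf.
case: (posnP t) => [->|t0]; first by exists (fun=> set0).
pose i0 : 'I_t := Ordinal t0.
exists (fun i => [set F (insubd i0 i, j) | j in [set: 'I_r]]).
  move=> i it; apply/cliquesP; split.
    by rewrite card_imset ?cardsT ?card_ord // => a b /FI[].
  apply/cliqueP => e se ce; rewrite -(preimset_imset _ _ _ se).
  have := FE (pair (insubd i0 i) @: ([set: 'I_r] :&: (fun j => F (insubd i0 i, j)) @^-1: e)).
  rewrite -imset_comp; apply.
  apply: imset2_f => //; rewrite inE; apply/eqP.
  rewrite -ce -[in RHS](preimset_imset _ _ _ se) [RHS]card_imset // => a b /FI[].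
  by [].
move=> i j it jt nij; apply/disjoint_notinP => v /imsetP[a _ ->]; apply/negP => /imsetP[b _ /FI[]].
move=> /(congr1 val); rewrite !val_insubd it jt => e.
by rewrite e eqxx in nij.
Qed.

(** * The bounded core *)

(** Each of [t] disjoint [r]-cliques would take at least [r - x] vertices of [L], which is too small
    for that. *)
Lemma hfree_of_core {p r t x : nat} {V : finType} (G : pgraph p V) (L : {set V}) :
  0 < r -> #|L| < t * (r - x) ->
  (forall Q, Q \in cliques r G -> #|Q :\: L| <= x) ->
  hfree (disjoint_copies t (complete_pgraph p r)) G.
Proof.
move=> r0 cL hQ; apply/hfree_disjoint_copiesP => // -[f fQ df].
move: cL; rewrite ltnNge => /negP; apply.
apply: (@leq_trans #|\bigcup_(i < t) (f i :&: L)|); last first.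
  by apply: subset_leq_card; apply/bigcupsP => i _; apply: subsetIr.
rewrite (@card_bigcup_disjoint _ _ (fun i => f i :&: L)); last first.
  by apply: pairwise_disjoint_sub df _ => i _; apply: subsetIl.
rewrite -[t in t * _]card_ord -sum_nat_const; apply: leq_sum => i _.
have := hQ _ (fQ i (ltn_ord i)); have /cliquesP[<- _] := fQ i (ltn_ord i).
by have := cardsID L (f i); lia.
Qed.

(** The kernel [J] is cut into [t] pieces of [r - b] vertices, one for each petal. A petal with its
    piece has at least [r] vertices and lies in the clique [J :|: f i]. *)
Lemma not_hfree_of_sunflower {p r t b : nat} {V : finType} (G : pgraph p V)
    (J : {set V}) (f : nat -> {set V}) :
  0 < r -> t * (r - b) <= #|J| -> pairwise_disjoint V t f ->
  (forall i, i < t -> [/\ #|f i| = b, [disjoint f i & J] & clique G (J :|: f i)]) ->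
  ~ hfree (disjoint_copies t (complete_pgraph p r)) G.
Proof.
move=> r0 cJ df hf /hfree_disjoint_copiesP; apply=> //.
have [g hg dg] := split_disjoint _ _ _ _ cJ.
have /fin_all_exists2[h hs hc] (i : 'I_t) :
    exists2 Q : {set V}, Q \subset f i :|: g i & #|Q| = r.
  have it := ltn_ord i; have [cf dfJ _] := hf i it; have [sg cg] := hg i it.
  apply: exists_subset_card.
  have -> : #|f i :|: g i| = #|f i| + #|g i|.
    by apply/eqP; rewrite (leq_card_setU _ _).2; apply: disjointWr dfJ.
  by rewrite cf cg; lia.
pose h' i := if insub i is Some i' then h i' else set0.
have h'E i (it : i < t) : h' i = h (Ordinal it) by rewrite /h' insubT.
exists h' => [i it|].
  rewrite h'E; apply/cliquesP; split=> //.
  have [_ _ cl] := hf i it; apply: cliqueS cl.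
  apply: subset_trans (hs _) _; rewrite setUC; apply: setSU.
  by have [] := hg i it.
apply: (@pairwise_disjoint_sub _ _ (fun i => f i :|: g i)); last first.
  by move=> i it; rewrite h'E; apply: hs.
move=> i j it jt nij; apply/disjoint_notinP => v; rewrite !inE negb_or.
have [_ dj _] := hf j jt; have [_ di _] := hf i it.
have [/subsetP sgi _] := hg i it; have [/subsetP sgj _] := hg j jt.
move=> /orP[vf|vg]; apply/andP; split.
- by rewrite (disjointFr (df i j it jt nij) vf).
- by apply/negP => /sgj; rewrite (disjointFr di vf).
- by rewrite (disjointFl dj (sgi _ vg)).
- by rewrite (disjointFr (dg i j it jt nij) vg).
Qed.

(* If the s-cliques whose trace on A is exactly J, with |J| = j, could not be
   hit outside A by a bounded set, their parts outside A would contain t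
   disjoint petals of a sunflower with kernel J. *)
Lemma bounded_core (p r s t q : nat) :
  0 < r -> (forall j, j < q -> t * (r - (s - j)) <= j) ->
  exists M, forall (V : finType) (G : pgraph p V),
    hfree (disjoint_copies t (complete_pgraph p r)) G ->
    exists2 A : {set V}, #|A| <= M & forall Q, Q \in cliques s G -> q <= #|Q :&: A|.
Proof.
move=> r0; elim: q => [|q IH] hq; first by exists 0 => V G _; exists set0; rewrite ?cards0.
have [|M hM] := IH; first by move=> j jq; apply: hq; apply: ltnW.
exists (M + 2 ^ M * (t * s)) => V G Gf; have [A cA hA] := hM V G Gf.
pose hits (J Z : {set V}) := (#|Z| <= t * s) &&
  [forall Q in cliques s G, (Q :&: A == J) ==> ~~ [disjoint Q :\: A & Z]].
have hitsP (J : {set V}) : #|J| = q -> exists Z, hits J Z.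
  move=> cJ; apply/existsP; case: (boolP [exists Z, hits J Z]) => // nex.
  exfalso.
  pose F := fun (_ : nat) (X : {set V}) =>
    exists Q, [/\ Q \in cliques s G, Q :&: A = J & X = Q :\: A].
  have [||f Ff df] := @greedy_transversal V t s F.
  - move=> i _ _ [Q [/cliquesP[<- _] _ ->]]; exact: subset_leq_card (subsetDl _ _).
  - move=> i Z _ cZ; move: nex; rewrite negb_exists => /forallP/(_ Z).
    rewrite /hits cZ /= negb_forall => /existsP[Q].
    rewrite !negb_imply => /and4P[Qs /eqP QA dQ _].
    by exists (Q :\: A) => //; exists Q.
  apply: (@not_hfree_of_sunflower p r t (s - q) V G J f) => //; first by rewrite cJ hq.
  move=> i it; have [Q [/cliquesP[cQ kQ] QA ->]] := Ff i it; split.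
  - by rewrite cardsD QA cQ cJ.
  - apply/disjoint_notinP => v; rewrite -QA !inE => /andP[/negbTE-> _].
    by rewrite andbF.
  - by rewrite -QA setID.
(* The default [set0] concerns only sets [J] without a hitting set; [hitsP] excludes these when
   [#|J| = q]. *)
pose B J := odflt set0 [pick Z | hits J Z].
have cB J : #|B J| <= t * s.
  by rewrite /B; case: pickP => [Z /andP[]//|_]; rewrite cards0.
(* A clique whose trace on [A] has only [q] vertices meets the hitting set of that trace outside
   [A], and so gains a vertex. *)
exists (A :|: \bigcup_(J in powerset A) B J).
  apply: leq_trans (leq_card_setU _ _) (leq_add cA _).
  apply: leq_trans (@card_bigcup_cond_leq _ _ _ (t * s) _ _) _ => //.
  by rewrite card_powerset leq_mul2r leq_exp2l ?cA ?orbT.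
move=> Q Qs; have := hA Q Qs; rewrite leq_eqVlt => /orP[/eqP cQ|lt]; last first.
  by apply: leq_trans lt _; apply: subset_leq_card; rewrite setIS ?subsetUl.
have [Z hZ] := hitsP (Q :&: A) (esym cQ).
have {Z hZ} /andP[_ /forall_inP hB] : hits (Q :&: A) (B (Q :&: A)).
  by rewrite /B; case: pickP => [//|/(_ Z)]; rewrite hZ.
have := hB Q Qs; rewrite eqxx /= -setI_eq0 => /set0Pn[v].
rewrite !inE => /andP[/andP[vA vQ] vB].
rewrite cQ; apply: proper_card; rewrite properE; apply/andP; split.
  by rewrite setIS ?subsetUl.
apply/subsetPn; exists v; last by rewrite !inE vQ.
rewrite !inE vQ (negbTE vA) /=; apply/bigcupP.
by exists (Q :&: A) => //; rewrite inE subsetIr.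
Qed.

Definition subsets_of {V : finType} (A : {set V}) (k : nat) : {set {set V}} :=
  [set S : {set V} | S \subset A & #|S| == k].

Lemma card_subsets_of {V : finType} (A : {set V}) (k : nat) :
  #|subsets_of A k| = 'C(#|A|, k).
Proof. exact: cards_draws. Qed.

Lemma leq_bin_exp (n k : nat) : 'C(n, k) <= n ^ k.
Proof.
apply: leq_trans (leq_pmulr _ (fact_gt0 k)) _; rewrite bin_ffact.
elim: k n => [|k IH] n; first by rewrite ffactn0.
rewrite ffactnS expnS leq_mul2l (leq_trans (IH _)) ?orbT //.
by case: k {IH} => // k; rewrite leq_exp2r ?leq_pred.
Qed.

Lemma leq_bin_exp2 (n k : nat) : 'C(n, k) <= 2 ^ n.
Proof.
have := cards_draws [set: 'I_n] k; rewrite cardsT card_ord => <-.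
rewrite -[n in 2 ^ n]card_ord -cardsT -card_powerset.
by apply: subset_leq_card; apply/subsetP => S; rewrite !inE => /andP[].
Qed.

Lemma card_imset2_leq (T1 T2 T : finType) (f : T1 -> T2 -> T) (A : {set T1}) (B : {set T2}) :
  #|[set f a b | a in A, b in B]| <= #|A| * #|B|.
Proof. by rewrite curry_imset2X (leq_trans (leq_imset_card _ _)) ?cardsX. Qed.

(* Since every s-clique has q vertices in A, it is the union of a q-subset of A
   and an arbitrary (s - q)-set. *)
Lemma card_cliques_leq {p s q : nat} {V : finType} {G : pgraph p V} {A : {set V}} :
  (forall Q, Q \in cliques s G -> q <= #|Q :&: A|) ->
  #|cliques s G| <= 2 ^ #|A| * #|V| ^ (s - q).
Proof.
move=> hA; apply: (@leq_trans #|[set S :|: X | S in powerset A, X in subsets_of [set: V] (s - q)]|).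
  apply: subset_leq_card; apply/subsetP => Q Qs.
  have [S sS cS] := exists_subset_card _ _ _ (hA Q Qs).
  have /cliquesP[cQ _] := Qs.
  have sSQ : S \subset Q by apply: subset_trans sS (subsetIl _ _).
  apply/imset2P; exists S (Q :\: S).
  - by rewrite inE; apply: subset_trans sS (subsetIr _ _).
  - by rewrite inE subsetT cardsD (setIidPr sSQ) cQ cS eqxx.
  - by rewrite -{1}(setIidPr sSQ) setID.
apply: leq_trans (card_imset2_leq _ _ _ _ _ _) _.
by rewrite card_powerset card_subsets_of cardsT leq_mul2l leq_bin_exp orbT.
Qed.

(** * Packing blocks into rich sets *)

(** For [k = r - x], a block is meant as the part inside the core of one of [t] disjoint copies of
    [K_r]. *)
Definition block_packing {V : finType} (R : {set {set V}}) (k n : nat)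
    (f : nat -> {set V}) : Prop :=
  pairwise_disjoint V n f /\
  forall i, i < n -> #|f i| = k /\ exists2 S, S \in R & f i \subset S.

Lemma bigcup_sup_ord {V : finType} {t : nat} (f : nat -> {set V}) {i : nat} :
  i < t -> f i \subset \bigcup_(i < t) f i.
Proof. by move=> it; apply: (bigcup_sup (Ordinal it)). Qed.

Lemma block_packing_rcons {V : finType} {R : {set {set V}}} {k n : nat}
    {f : nat -> {set V}} {S P : {set V}} :
  block_packing R k n f -> S \in R -> P \subset S -> #|P| = k ->
  [disjoint P & \bigcup_(i < n) f i] ->
  exists2 g, block_packing R k n.+1 g
    & \bigcup_(i < n.+1) g i = \bigcup_(i < n) f i :|: P.
Proof.
move=> [df hf] SR sP cP dP.
exists (fun i => if i < n then f i else P).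
  split=> [|i]; last first.
    by rewrite ltnS => iN; case: ltnP => [/hf//|_]; split=> //; exists S.
  rewrite -addn1; apply: (pairwise_disjoint_cat _ _ 1 _ (fun=> P) df).
    by move=> i j; lia.
  by move=> i j iN _; rewrite disjoint_sym; apply: disjointWr (bigcup_sup_ord f iN) dP.
rewrite big_ord_recr /= ltnn; congr (_ :|: P).
by apply: eq_bigr => i _; rewrite ltn_ord.
Qed.

Lemma block_packing_complete {V : finType} {R : {set {set V}}} {k t n : nat}
    {f : nat -> {set V}} {S : {set V}} :
  block_packing R k n f -> S \in R -> n <= t ->
  (t - n) * k <= #|S :\: \bigcup_(i < n) f i| ->
  exists g, block_packing R k t g.
Proof.
move=> [df hf] SR nt hS; have [g hg dg] := split_disjoint _ _ _ _ hS.
exists (fun i => if i < n then f i else g (i - n)); split; last first.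
  move=> i it; case: ltnP => [/hf//|ni].
  have [|sg cg] := hg (i - n); first by lia.
  by split=> //; exists S => //; apply: subset_trans sg (subsetDl _ _).
rewrite -(subnKC nt); apply: pairwise_disjoint_cat df dg _ => i j iN jN.
have [sg _] := hg j jN; rewrite disjoint_sym; apply: disjointWl sg _.
apply: disjointWr (bigcup_sup_ord f iN) _.
by apply/disjoint_notinP => v; rewrite inE => /andP[].
Qed.

(** A block outside [S0] is added as long as some member of [R] has room for one; the second
    alternative is the case where this stops early. *)
Lemma block_packing_maximal {V : finType} (R : {set {set V}}) (S0 : {set V}) (k t : nat) :
  0 < k -> exists n f, [/\ n <= t, block_packing R k n f,
    [disjoint \bigcup_(i < n) f i & S0] &
    n = t \/ forall S, S \in R -> #|S :\: S0 :\: \bigcup_(i < n) f i| < k].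
Proof.
move=> k0; elim: t => [|t [n [f [nt pf df hn]]]].
  exists 0, (fun=> set0); split=> //; last by left.
  by rewrite big_ord0; apply/disjoint_notinP => v; rewrite inE.
case: hn => [en|hn]; last by exists n, f; split=> //; [apply: leqW | right].
subst n.
case: (boolP [forall S in R, #|S :\: S0 :\: \bigcup_(i < t) f i| < k]).
  by move=> /forall_inP h; exists t, f; split=> //; right.
rewrite negb_forall => /existsP[S]; rewrite negb_imply -leqNgt => /andP[SR hS].
have [P sP cP] := exists_subset_card _ _ _ hS.
have sPS : P \subset S by apply: subset_trans sP _; rewrite setDDl subsetDl.
have dP : [disjoint P & \bigcup_(i < t) f i].
  apply: disjointWl sP _.
  by apply/disjoint_notinP => v; rewrite inE => /andP[].
have [g pg ug] := block_packing_rcons pf SR sPS cP dP.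
exists t.+1, g; split=> //; last by left.
rewrite ug; apply/disjoint_notinP => v; rewrite inE => /orP[vf|].
  by rewrite (disjointFr df vf).
by move=> /(subsetP sP); rewrite !inE => /and3P[].
Qed.

(* First take as many blocks as possible outside a fixed S0 in R; then take
   blocks with a single vertex outside S0 until tk - q outside vertices are
   used; the rest of S0 then has exactly enough room for the missing blocks. *)
Lemma exists_block_packing {V : finType} (R : {set {set V}}) (k t q : nat) :
  0 < k -> k.-1 * t < q -> q < t * k -> (forall S, S \in R -> #|S| = q) ->
  t * k <= #|cover R| -> exists f, block_packing R k t f.
Proof.
move=> k0 hq1 hq2 hR hU.
have [S0 S0R] : exists S0, S0 \in R.
  apply/set0Pn; apply: contraTneq hU => ->; rewrite /cover big_set0 cards0.
  by rewrite -ltnNge; apply: leq_ltn_trans hq2.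
have cS0 := hR S0 S0R.
have [n [f [nt pf df hn]]] := block_packing_maximal R S0 k t k0.
case: hn => [en|hn]; first by subst n; exists f.
(* [t] blocks must use at least [D] vertices outside [S0], since [S0] offers only [q]. *)
have [D hD] : exists D, D = t * k - q by exists (t * k - q).
set U1 := \bigcup_(i < n) f i in df hn.
have cU1 : #|U1| <= n * k by apply: card_bigcup_leq => i /(pf.2)[->].
(* If the first blocks already use [D] outside vertices, the untouched [S0] has room for the [t - n]
   missing blocks. *)
case: (leqP D (n * k)) => hnk.
  apply: block_packing_complete pf S0R nt _.
  suff -> : S0 :\: \bigcup_(i < n) f i = S0 by rewrite mulnBl; lia.
  by apply/setDidPl; rewrite disjoint_sym.
have phase2 m : n * k + m <= D -> exists g, [/\ block_packing R k (n + m) g,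
    U1 \subset \bigcup_(i < n + m) g i,
    #|\bigcup_(i < n + m) g i :\: S0| <= n * k + m &
    #|\bigcup_(i < n + m) g i :&: S0| <= k.-1 * m].
  elim: m => [|m IH] hm.
    rewrite addn0; exists f; split=> //.
      by rewrite addn0; apply: leq_trans cU1; apply: subset_leq_card (subsetDl _ _).
    by rewrite (disjoint_setI0 df) cards0.
  have [|g [pg sU1 oU iU]] := IH; first by lia.
  set U := \bigcup_(i < n + m) g i in sU1 oU iU.
  (* A fresh outside vertex [w] exists: [R] covers at least [t * k - q = D] vertices outside [S0],
     and fewer than [D] are used. *)
  have /subsetPn[w] : ~~ (cover R :\: S0 \subset U :\: S0).
    apply: contraTN hm => /subset_leq_card; rewrite (cardsD (cover R)).
    have : #|cover R :&: S0| <= q by rewrite -cS0; apply: subset_leq_card (subsetIr _ _).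
    by rewrite -ltnNge; lia.
  rewrite !inE => /andP[wS0 /bigcupP[S SR wS]]; rewrite wS0 /= => wU.
  have cS := hR S SR.
  (* The rest of the block comes from [S :&: S0]: by maximality of the first phase [S] has few
     vertices outside [S0], and each block of the second phase uses at most [k - 1] vertices of
     [S0]. *)
  have kS : k.-1 <= #|S :&: S0 :\: U|.
    case: (posnP k.-1) => [->//|k1].
    have h1 : #|S :\: S0| <= k.-1 + n * k.
      rewrite -(cardsID U1) addnC; apply: leq_add.
        by have := hn S SR; lia.
      by apply: leq_trans cU1; apply: subset_leq_card (subsetIr _ _).
    have h2 : #|S :&: S0 :&: U| <= k.-1 * m.
      apply: leq_trans iU; apply: subset_leq_card; apply/subsetP => v.
      by rewrite !inE => /andP[/andP[_ ->] ->].
    have h3 := cardsID S0 S; have h4 := cardsID U (S :&: S0).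
    (* From [q > (k - 1) t] and [D = t k - q] follows [(k - 1) D + k <= q]; it remains to insert
       [n k + m + 1 <= D] and [k >= 2]. *)
    suff : k.-1 + (k.-1 + n * k) + k.-1 * m <= q by lia.
    clear - k1 hq1 hm hD hq2; case: k k1 hq1 hm hD hq2 => // -[|a] _ //= hq1 hm hD hq2.
    have e1 : a.+1 * (n * a.+2 + m.+1) <= a.+1 * D by rewrite leq_mul2l hm orbT.
    have e2 : a.+2 * (a.+1 * t).+1 <= a.+2 * q by rewrite leq_mul2l hq1 orbT.
    have e3 : a.+1 * D + a.+1 * q = a.+1 * (t * a.+2) by rewrite hD -mulnDr subnK // ltnW.
    have e4 : a.+2 * q = a.+1 * q + q by rewrite mulSn addnC.
    have e5 : a.+2 * (a.+1 * t).+1 = a.+1 * (t * a.+2) + a.+2 by lia.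
    have e6 : n * a.+2 <= a.+1 * (n * a.+2) by rewrite leq_pmull.
    have e7 : a.+1 * (n * a.+2 + m.+1) = a.+1 * (n * a.+2) + a.+1 * m + a.+1 by lia.
    by lia.
  have [Z sZ cZ] := exists_subset_card _ _ _ kS.
  have wZ : w \notin Z.
    by apply/negP => /(subsetP sZ); rewrite !inE (negbTE wS0) !andbF.
  have sP : w |: Z \subset S.
    rewrite subUset sub1set wS; apply: subset_trans sZ _.
    by rewrite setDE -setIA subsetIl.
  have cP : #|w |: Z| = k by rewrite cardsU1 wZ cZ add1n prednK.
  have dP : [disjoint w |: Z & U].
    apply/disjoint_notinP => v; rewrite !inE => /orP[/eqP->//|].
    by move=> /(subsetP sZ); rewrite !inE => /andP[].
  have [h ph uh] := block_packing_rcons pg SR sP cP dP.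
  exists h; rewrite addnS uh; split=> //.
  - by apply: subset_trans sU1 (subsetUl _ _).
  - rewrite setDUl addnS -addn1; apply: leq_trans (leq_card_setU _ _) _.
    apply: leq_add => //; apply: (@leq_trans #|[set w]|); last by rewrite cards1.
    apply: subset_leq_card; apply/subsetP => v; rewrite !inE => /andP[vS0 /orP[//|]].
    by move=> /(subsetP sZ); rewrite !inE (negbTE vS0) !andbF.
  - rewrite setIUl mulnS [X in _ <= X]addnC; apply: leq_trans (leq_card_setU _ _) _.
    apply: leq_add => //; rewrite -cZ.
    apply: subset_leq_card; apply/subsetP => v; rewrite !inE => /andP[/orP[/eqP->|//]].
    by rewrite (negbTE wS0).
have [|g [pg _ _ iU]] := phase2 (D - n * k); first by lia.
(* [D < t] follows from [q > (k - 1) t]. *)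
have hnD : n + (D - n * k) <= t.
  have e1 : n <= n * k by rewrite leq_pmulr.
  have e2 : t * k = k.-1 * t + t by rewrite mulnC -{1}(prednK k0) mulSn addnC.
  by lia.
apply: block_packing_complete pg S0R hnD _.
rewrite cardsD cS0 setIC.
have e1 X : k.-1 * X + X = k * X by rewrite -[in RHS](prednK k0) mulSnr.
have {}e1 := e1 (D - n * k).
have e2 : (t - (n + (D - n * k))) * k = t * k - n * k - k * (D - n * k).
  by rewrite mulnBl mulnDl subnDA (mulnC (D - _)).
by rewrite e2; lia.
Qed.

(** * Pullbacks and links *)

(** For injective [h] this is the subgraph induced on the image of [h], relabelled by [W]. It moves
    graphs to the vertex types ['I_n] over which [hex] and the bound on [T] range. *)
Definition pullback_edges {p : nat} {W V : finType} (h : W -> V) (G : pgraph p V) :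
  {set {set W}} := [set e : {set W} | (#|e| == p) && (h @: e \in hedges G)].

Lemma pullback_uniform {p : nat} {W V : finType} (h : W -> V) (G : pgraph p V) :
  p_uniform p (pullback_edges h G).
Proof. by apply/forall_inP => e; rewrite inE => /andP[]. Qed.

Definition pullback {p : nat} {W V : finType} (h : W -> V) (G : pgraph p V) : pgraph p W :=
  PGraph (pullback_uniform h G).

Lemma cliques_pullback {p k : nat} {W V : finType} {h : W -> V} (G : pgraph p V) (Y : {set W}) :
  injective h -> (Y \in cliques k (pullback h G)) = (h @: Y \in cliques k G).
Proof.
move=> hI; rewrite !inE card_imset //; congr (_ && _).
apply/cliqueP/cliqueP => hc e se ce.
  have := hc (Y :&: h @^-1: e) (subsetIl _ _).
  by rewrite inE preimset_imset // -[#|Y :&: _|](card_imset _ hI) preimset_imset // ce eqxx; apply.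
by rewrite inE ce eqxx; apply: hc; rewrite ?imsetS ?card_imset.
Qed.

Lemma leq_card_cliques_pullback {p k : nat} {W V : finType} {h : W -> V} (G : pgraph p V)
    (F : {set {set V}}) :
  injective h -> (forall X, X \in F -> X \subset h @: [set: W]) ->
  F \subset cliques k G -> #|F| <= #|cliques k (pullback h G)|.
Proof.
move=> hI hF /subsetP sF.
apply: leq_trans (leq_imset_card (fun Y : {set W} => h @: Y) _).
apply: subset_leq_card; apply/subsetP => X XF; apply/imsetP.
have eX := preimset_imset _ _ _ (hF X XF).
by exists ([set: W] :&: h @^-1: X) => //; rewrite cliques_pullback // eX sF.
Qed.

Lemma hfree_pullback {p r t : nat} {W V : finType} {h : W -> V} (G : pgraph p V) :
  0 < r -> injective h -> hfree (disjoint_copies t (complete_pgraph p r)) G ->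
  hfree (disjoint_copies t (complete_pgraph p r)) (pullback h G).
Proof.
move=> r0 hI /hfree_disjoint_copiesP-/(_ r0) hG.
apply/hfree_disjoint_copiesP => // -[f hf df]; apply: hG.
exists (fun i => h @: f i) => [i /hf|i j it jt nij]; first by rewrite cliques_pullback.
by rewrite imset_disjoint //; apply: df.
Qed.

Lemma leq_ncopies_hex {p r s t n : nat} {V : finType} (G : pgraph p V) :
  0 < r -> #|V| = n -> hfree (disjoint_copies t (complete_pgraph p r)) G ->
  ncopies (complete_pgraph p s) G
    <= hex n (complete_pgraph p s) (disjoint_copies t (complete_pgraph p r)).
Proof.
move=> r0 cV Gf; rewrite ncopies_complete.
have [|h hI hT] := @ex_inj_onto V n [set: V]; first by rewrite cardsT.
apply: leq_trans (leq_bigmax_cond _ (hfree_pullback G r0 hI Gf)).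
rewrite ncopies_complete.
by apply: leq_card_cliques_pullback => // X _; rewrite hT subsetT.
Qed.

(** Choose a vertex of [Z] first; the remaining [x - 1] vertices are arbitrary. *)
Lemma card_meeting {V : finType} (Z : {set V}) (x : nat) :
  0 < x -> #|[set X : {set V} | (#|X| == x) && ~~ [disjoint X & Z]]| <= #|Z| * #|V| ^ x.-1.
Proof.
move=> x0; apply: (@leq_trans #|[set z |: Y | z in Z, Y in subsets_of [set: V] x.-1]|).
  apply: subset_leq_card; apply/subsetP => X; rewrite !inE -setI_eq0.
  move=> /andP[/eqP cX /set0Pn[z]]; rewrite inE => /andP[zX zZ].
  apply/imset2P; exists z (X :\ z) => //; last by rewrite setD1K.
  by rewrite inE subsetT -cX (cardsD1 z X) zX eqxx.
apply: leq_trans (card_imset2_leq _ _ _ _ _ _) _.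
by rewrite card_subsets_of cardsT leq_mul2l leq_bin_exp orbT.
Qed.

(** Unlike the usual link, this one is again [p]-uniform, so that it can be compared with
    [K_{x+1}^p]-free [p]-graphs. *)
Definition link_edges {p : nat} {V : finType} (G : pgraph p V) (A S : {set V}) :=
  [set e : {set V} | [&& #|e| == p, [disjoint e & A] & clique G (S :|: e)]].

Lemma link_uniform {p : nat} {V : finType} (G : pgraph p V) (A S : {set V}) :
  p_uniform p (link_edges G A S).
Proof. by apply/forall_inP => e; rewrite inE => /and3P[]. Qed.

Definition link {p : nat} {V : finType} (G : pgraph p V) (A S : {set V}) : pgraph p V :=
  PGraph (link_uniform G A S).

Definition petals {p : nat} {V : finType} (G : pgraph p V) (A S : {set V}) (x : nat) :=
  [set X : {set V} | [&& #|X| == x, [disjoint X & A] & clique G (S :|: X)]].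

Lemma petals_sub_cliques_link {p x : nat} {V : finType} (G : pgraph p V) (A S : {set V}) :
  petals G A S x \subset cliques x (link G A S).
Proof.
apply/subsetP => X; rewrite !inE => /and3P[-> dX cX] /=.
apply/cliqueP => e se ce; rewrite inE ce eqxx (disjointWl se dX) /=.
by apply: cliqueS cX; apply: setUS.
Qed.

(* An (x+1)-clique of the link together with q - 1 vertices of S would be an
   s-clique with too few vertices in A. *)
Lemma link_cliques_eq0 {p s q x : nat} {V : finType} (G : pgraph p V) (A S : {set V}) :
  0 < p -> p <= x.+1 -> 0 < q -> q + x = s ->
  (forall Q, Q \in cliques s G -> q <= #|Q :&: A|) ->
  S \subset A -> #|S| = q -> cliques x.+1 (link G A S) = set0.
Proof.
move=> p0 px q0 qx hA sSA cS; apply/eqP/negPn/negP => /set0Pn[W /cliquesP[cW /cliqueP kW]].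
(* Since [p <= x + 1], every vertex of [W] lies in an edge of the link, and such edges avoid [A]. *)
have dW : [disjoint W & A].
  apply/disjoint_notinP => v vW.
  have [||e [ve seW ce]] := @exists_subset_between V [set v] W p.
  - by rewrite sub1set.
  - by rewrite cards1 p0 cW.
  have := kW e seW ce; rewrite inE => /and3P[_ de _].
  by rewrite (disjointFr de) // -sub1set.
(* The part of [f] in [W] extends to a [p]-subset [e] of [W]; as [e] is an edge of the link,
   [S :|: e] is a clique containing [f]. *)
have cSW : clique G (S :|: W).
  apply/cliqueP => f sf cf.
  have [||e [fe seW ce]] := @exists_subset_between V (f :&: W) W p.
  - by apply: subsetIr.
  - by rewrite cW px -cf subset_leq_card ?subsetIl.
  have := kW e seW ce; rewrite inE => /and3P[_ _ /cliqueP]; apply=> //.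
  apply/subsetP => v vf; have := subsetP sf v vf; rewrite !inE => /orP[->//|vW].
  by rewrite (subsetP fe) ?orbT // inE vf.
have [|S' sS cS'] := exists_subset_card _ S q.-1 _; first by rewrite cS leq_pred.
have dS' : [disjoint S' & W].
  by rewrite disjoint_sym; apply: disjointWr dW; apply: subset_trans sSA.
have /hA : S' :|: W \in cliques s G.
  apply/cliquesP; split; last by apply: cliqueS cSW; apply: setSU.
  have -> : #|S' :|: W| = #|S'| + #|W| by apply/eqP; rewrite (leq_card_setU _ _).2.
  by lia.
rewrite setIUl (disjoint_setI0 dW) setU0 leqNgt => /negP; apply.
apply: (@leq_trans #|S'|.+1); last by rewrite cS' prednK.
by rewrite ltnS subset_leq_card // subsetIl.
Qed.

(** * The sharp upper bound *)

(** The link of [S] is restricted to the complement of an [l]-subset of [A]. This leaves exactly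
    [n - l] vertices, loses no petal and creates no [(x+1)]-clique, so [N] bounds its
    [x]-cliques. *)
Lemma card_petals_leq {p s q x l n : nat} {G : pgraph p 'I_n} {A S : {set 'I_n}} {N : nat} :
  0 < p -> p <= x.+1 -> 0 < q -> q + x = s -> l <= #|A| ->
  (forall Q, Q \in cliques s G -> q <= #|Q :&: A|) ->
  (forall T : pgraph p 'I_(n - l), hfree (complete_pgraph p x.+1) T ->
     ncopies (complete_pgraph p x) T <= N) ->
  S \subset A -> #|S| = q -> #|petals G A S x| <= N.
Proof.
move=> p0 px q0 qx lA hA hN sSA cS.
have [A0 sA0 cA0] := exists_subset_card _ _ _ lA.
have [|h hI hT] := @ex_inj_onto _ (n - l) (~: A0).
  by have := cardsC A0; rewrite card_ord; lia.
apply: leq_trans (hN (pullback h (link G A S)) _); last first.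
  rewrite hfree_complete; apply/eqP/setP => Y; rewrite cliques_pullback //.
  by rewrite (link_cliques_eq0 _ _ _ _ _ _ _ hA) ?inE.
rewrite ncopies_complete; apply: leq_card_cliques_pullback (petals_sub_cliques_link _ _ _) => //.
move=> X; rewrite hT inE => /and3P[_ dX _].
by rewrite -disjoints_subset; apply: disjointWr dX.
Qed.

(* A q-subset of the core is rich when its petals have no hitting set of size
   at most t x, so that t disjoint petals can be chosen for any t rich sets. *)
Definition rich {p : nat} {V : finType} (G : pgraph p V) (A : {set V}) (q c x : nat) :=
  [set S in subsets_of A q |
    [forall Z : {set V}, (#|Z| <= c) ==> [exists X in petals G A S x, [disjoint X & Z]]]].

Lemma cover_rich_lt {p r t k q x : nat} {V : finType} {G : pgraph p V} {A : {set V}} :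
  hfree (disjoint_copies t (complete_pgraph p r)) G ->
  0 < k -> k + x = r -> k.-1 * t < q -> q < t * k ->
  #|cover (rich G A q (t * x) x)| < t * k.
Proof.
move=> Gf k0 kx hq1 hq2; rewrite ltnNge; apply/negP => hU.
have [|f [df hf]] := @exists_block_packing _ (rich G A q (t * x) x) k t q k0 hq1 hq2 _ hU.
  by move=> S; rewrite !inE => /andP[/andP[_ /eqP]].
have fA i : i < t -> f i \subset A.
  move=> /hf[_ [S]]; rewrite !inE => /andP[/andP[sSA _] _] sf.
  exact: subset_trans sSA.
(* A petal of a rich set is also a petal of any block inside it, and richness provides one that
   avoids the at most [t * x] vertices already used. *)
have [||X hX dX] := @greedy_transversal V t x (fun i X => X \in petals G A (f i) x).
- by move=> i X it; rewrite inE => /and3P[/eqP->].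
- move=> i Z /hf[_ [S]]; rewrite !inE => /andP[_ /forallP/(_ Z)] + sf cZ.
  rewrite cZ => /existsP[X]; rewrite inE => /andP[/and3P[cX dX kX] dXZ].
  by exists X => //; rewrite inE cX dX /=; apply: cliqueS kX; apply: setSU.
have r0 : 0 < r by rewrite -kx addn_gt0 k0.
have dfX i j : i < t -> j < t -> [disjoint f i & X j].
  move=> it jt; have := hX j jt; rewrite inE disjoint_sym => /and3P[_ dXA _].
  by apply: disjointWl (fA i it) dXA.
move: Gf => /hfree_disjoint_copiesP-/(_ r0); apply.
exists (fun i => f i :|: X i) => [i it|i j it jt nij].
  have := hX i it; rewrite inE => /and3P[/eqP cX _ kX].
  apply/cliquesP; split=> //; rewrite -kx -cX -(hf i it).1.
  by apply/eqP; rewrite (leq_card_setU _ _).2 dfX.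
apply/disjoint_notinP => v; rewrite !inE negb_or => /orP[vf|vX].
  by rewrite (disjointFr (df i j it jt nij) vf) (disjointFr (dfX i j it jt) vf).
by rewrite (disjointFl (dfX j i jt it) vX) (disjointFr (dX i j it jt nij) vX).
Qed.

Lemma card_rich_leq {p r t k q x : nat} {V : finType} {G : pgraph p V} {A : {set V}} :
  hfree (disjoint_copies t (complete_pgraph p r)) G ->
  0 < k -> k + x = r -> k.-1 * t < q -> q < t * k ->
  #|rich G A q (t * x) x| <= 'C(t * k - 1, q).
Proof.
move=> Gf k0 kx hq1 hq2; set R := rich _ _ _ _ _.
apply: (@leq_trans #|subsets_of (cover R) q|).
  apply: subset_leq_card; apply/subsetP => S SR; rewrite inE.
  have := SR; rewrite !inE => /andP[/andP[_ ->] _]; rewrite andbT.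
  exact: (bigcup_sup S).
rewrite card_subsets_of; apply: leq_bin2l.
by rewrite subn1 -ltnS prednK ?(cover_rich_lt Gf) //; apply: leq_ltn_trans hq2.
Qed.

Lemma hex_leq_bin_mul {p r s t x k q : nat} :
  0 < p -> p <= x.+1 -> 0 < x -> 0 < k -> k + x = r -> q + x = s ->
  k.-1 * t < q -> q < t * k -> (forall j, j < q -> t * (r - (s - j)) <= j) ->
  exists C, forall n N,
    t * k - 1 <= n ->
    (forall T : pgraph p 'I_(n - (t * k - 1)), hfree (complete_pgraph p x.+1) T ->
       ncopies (complete_pgraph p x) T <= N) ->
    hex n (complete_pgraph p s) (disjoint_copies t (complete_pgraph p r))
      <= 'C(t * k - 1, q) * N + C * n ^ x.-1.
Proof.
move=> p0 px x0 k0 kx qx hq1 hq2 hc; set l := t * k - 1.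
have q0 : 0 < q by apply: leq_ltn_trans hq1.
have r0 : 0 < r by rewrite -kx addn_gt0 k0.
have [M hM] := bounded_core p r s t q r0 hc.
(* The first summand bounds the cliques over sets that are not rich, the second those with a vertex
   of [A] besides the [q]-set; [2 ^ (M + l)] bounds the number of [q]-subsets of [A]. *)
exists (2 ^ (M + l) * (t * x) + 2 ^ (M + l) * (M + l)) => n N ln hN.
apply/bigmax_leqP => G Gf; rewrite ncopies_complete.
(* A core with fewer than [l] vertices is enlarged to [l], because [card_petals_leq] deletes [l] of
   its vertices. *)
have [A [cA1 cA2 hA]] : exists A : {set 'I_n}, [/\ l <= #|A|, #|A| <= M + l &
    forall Q, Q \in cliques s G -> q <= #|Q :&: A|].
  have [A cA hA] := hM _ G Gf.
  case: (leqP l #|A|) => lA; first by exists A; split=> //; apply: leq_trans cA (leq_addr _ _).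
  have [||B [sAB _ cB]] := @exists_subset_between _ A setT l; first exact: subsetT.
    by rewrite ltnW // cardsT card_ord.
  exists B; rewrite cB leqnn leq_addl; split=> // Q /hA h.
  by apply: leq_trans h _; apply: subset_leq_card; apply: setIS.
have cpow S : #|subsets_of A S| <= 2 ^ (M + l).
  by rewrite card_subsets_of; apply: leq_trans (leq_bin_exp2 _ _) _; rewrite leq_exp2l.
pose R := rich G A q (t * x) x.
pose P := subsets_of A q :\: R.
pose m := [set X : {set 'I_n} | (#|X| == x) && ~~ [disjoint X & A]].
have sub : cliques s G \subset
    (\bigcup_(S in R) [set S :|: X | X in petals G A S x]) :|:
    (\bigcup_(S in P) [set S :|: X | X in petals G A S x]) :|:
    [set S :|: X | S in subsets_of A q, X in m].
  apply/subsetP => Q Qs; have /cliquesP[cQ kQ] := Qs.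
  have [S sS cS] := exists_subset_card _ _ _ (hA Q Qs).
  have sSQ : S \subset Q by apply: subset_trans sS (subsetIl _ _).
  have sSA : S \subset A by apply: subset_trans sS (subsetIr _ _).
  have eQ : Q = S :|: (Q :\: S) by rewrite -{1}(setIidPr sSQ) setID.
  have cX : #|Q :\: S| == x by rewrite cardsD (setIidPr sSQ) cQ cS -qx addKn.
  have SA : S \in subsets_of A q by rewrite inE sSA cS eqxx.
  case: (boolP [disjoint Q :\: S & A]) => dX.
    have XS : Q :\: S \in petals G A S x by rewrite inE cX dX -eQ.
    rewrite inE; apply/orP; left; rewrite inE; apply/orP.
    case: (boolP (S \in R)) => SR; [left|right]; apply/bigcupP; exists S => //.
    - by apply/imsetP; exists (Q :\: S).
    - by rewrite inE SR.
    - by apply/imsetP; exists (Q :\: S).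
  rewrite inE; apply/orP; right; apply/imset2P; exists S (Q :\: S) => //.
  by rewrite inE cX.
apply: leq_trans (subset_leq_card sub) _.
rewrite mulnDl addnA; apply: leq_trans (leq_card_setU _ _) (leq_add _ _).
  apply: leq_trans (leq_card_setU _ _) (leq_add _ _).
    apply: leq_trans (@card_bigcup_cond_leq _ _ _ N _ _) _.
      move=> S; rewrite !inE => /andP[/andP[sSA /eqP cS] _].
      apply: leq_trans (leq_imset_card _ _) _.
      exact: (card_petals_leq p0 px q0 qx cA1 hA hN).
    by rewrite leq_mul2r (card_rich_leq Gf k0) ?orbT.
  apply: leq_trans (@card_bigcup_cond_leq _ _ _ (t * x * n ^ x.-1) _ _) _.
    move=> S; rewrite !inE => /andP[nR SA].
    (* A set that is not rich has few petals, as they all meet one bounded set [Z]. *)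
    have {nR} [Z cZ hZ] : exists2 Z : {set 'I_n}, #|Z| <= t * x &
        petals G A S x \subset [set X : {set 'I_n} | (#|X| == x) && ~~ [disjoint X & Z]].
      move: nR; rewrite SA /= negb_forall => /existsP[Z].
      rewrite negb_imply => /andP[cZ /existsPn hZ]; exists Z => //.
      apply/subsetP => X XS; have := hZ X; rewrite XS /= inE => ->.
      by move: XS; rewrite inE => /andP[->].
    apply: leq_trans (leq_imset_card _ _) _; apply: leq_trans (subset_leq_card hZ) _.
    by apply: leq_trans (card_meeting Z x x0) _; rewrite card_ord leq_mul2r cZ orbT.
  rewrite -[X in _ <= X]mulnA leq_mul2r; apply/orP; right.
  by apply: leq_trans (cpow q); apply: subset_leq_card; apply: subsetDl.
apply: leq_trans (card_imset2_leq _ _ _ _ _ _) _.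
rewrite -mulnA; apply: leq_mul (cpow q) _.
by apply: leq_trans (card_meeting A x x0) _; rewrite card_ord leq_mul2r cA2 orbT.
Qed.

(** * Lower bounds *)

(** For positive [p] an edge coming from the first part has a vertex there, so an edge inside the
    second part comes from [T]. *)
Lemma hjoin_edge_inr {p l : nat} {V : finType} (T : pgraph p V) (e : {set V}) :
  0 < p -> inr @: e \in hedges (hjoin (complete_pgraph p l) T) -> e \in hedges T.
Proof.
move=> p0; rewrite !inE => /orP[/orP[/imsetP[e' he' ee]|/imsetP[e' he' ee]]|].
- move: he'; rewrite inE => /eqP ce'.
  have [v ve] : exists v, v \in e' by apply/set0Pn; rewrite -card_gt0 ce'.
  have : @inl 'I_l V v \in inl @: e' by apply: imset_f.
  by rewrite -ee => /imsetP[].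
- by rewrite (imset_inj _ ee) // => a b [].
- by case/and3P => _ /existsP[v /imsetP[]].
Qed.

Lemma hfree_hjoin {p r t x l : nat} {V : finType} (T : pgraph p V) :
  0 < p -> 0 < r -> l < t * (r - x) -> hfree (complete_pgraph p x.+1) T ->
  hfree (disjoint_copies t (complete_pgraph p r)) (hjoin (complete_pgraph p l) T).
Proof.
move=> p0 r0 hl; rewrite hfree_complete => /eqP hT.
have inrI : injective (@inr 'I_l V) by move=> a b [].
apply: (@hfree_of_core _ _ _ x _ _ (inl @: [set: 'I_l])) => //.
  by rewrite card_imset ?cardsT ?card_ord // => a b [].
move=> Q /cliquesP[_ /cliqueP kQ]; rewrite leqNgt; apply/negP => cQ.
have sQ : Q :\: inl @: [set: 'I_l] \subset inr @: [set: V].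
  apply/subsetP => -[a|v]; rewrite inE => /andP[h _]; last exact: imset_f.
  by rewrite imset_f in h.
have [X sX cX] := exists_subset_card _ _ _ cQ.
have eX := preimset_imset _ _ _ (subset_trans sX sQ).
set Y := _ :&: _ in eX.
suff : Y \in cliques x.+1 T by rewrite hT inE.
apply/cliquesP; split; first by rewrite -cX -eX card_imset.
apply/cliqueP => e se ce; apply: (hjoin_edge_inr _ _ p0); apply: kQ; last by rewrite card_imset.
apply: subset_trans (imsetS _ se) _; rewrite eX.
by apply: subset_trans sX (subsetDl _ _).
Qed.

Lemma clique_hjoin {p l : nat} {V : finType} (T : pgraph p V) (S : {set 'I_l}) (X : {set V}) :
  clique T X -> clique (hjoin (complete_pgraph p l) T) (inl @: S :|: inr @: X).
Proof.
move=> /cliqueP kX; apply/cliqueP => e /subsetP se ce; rewrite !inE.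
have cimset (W : finType) (f : W -> 'I_l + V) (A : {set W}) :
    injective f -> e \subset f @: A -> #|A :&: f @^-1: e| = p.
  by move=> fI sA; rewrite -ce -[in RHS](preimset_imset _ _ _ sA) card_imset.
case: (boolP [exists v, @inl 'I_l V v \in e]) => [/existsP hl|nl]; last first.
  have sX : e \subset inr @: X.
    apply/subsetP => -[a ae|v /se]; first by case/existsP: nl; exists a.
    by rewrite inE => /orP[/imsetP[]|].
  apply/orP; left; apply/orP; right.
  rewrite -(preimset_imset _ _ _ sX); apply: imset_f; apply: kX; first exact: subsetIl.
  by apply: cimset => // a b [].
case: (boolP [exists v, @inr 'I_l V v \in e]) => [/existsP hr|nr].
  by apply/orP; right; apply/and3P; split; first by apply/eqP.
have sS : e \subset inl @: S.
  apply/subsetP => -[a /se|v ve]; last by case/existsP: nr; exists v.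
  by rewrite inE => /orP[//|/imsetP[]].
apply/orP; left; apply/orP; left.
rewrite -(preimset_imset _ _ _ sS); apply: imset_f; rewrite inE; apply/eqP.
by apply: cimset => // a b [].
Qed.

Lemma ncopies_hjoin_geq {p l q x s : nat} {V : finType} (T : pgraph p V) :
  q + x = s -> 'C(l, q) * ncopies (complete_pgraph p x) T
    <= ncopies (complete_pgraph p s) (hjoin (complete_pgraph p l) T).
Proof.
move=> <-; rewrite !ncopies_complete.
have <- : #|subsets_of [set: 'I_l] q| = 'C(l, q) by rewrite card_subsets_of cardsT card_ord.
rewrite -cardsX.
pose f (u : {set 'I_l} * {set V}) : {set 'I_l + V} := inl @: u.1 :|: inr @: u.2.
have fl u a : (inl a \in f u) = (a \in u.1).
  rewrite inE; apply/orP/idP => [[/imsetP[b bu [->]]//|/imsetP[]//]|au].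
  by left; apply: imset_f.
have fr u a : (inr a \in f u) = (a \in u.2).
  rewrite inE; apply/orP/idP => [[/imsetP[]//|/imsetP[b bu [->]]//]|au].
  by right; apply: imset_f.
have fI : injective f.
  move=> u v e; apply/eqP; rewrite -pair_eqE; apply/andP; split; apply/eqP/setP => a.
    by rewrite -!fl e.
  by rewrite -!fr e.
rewrite -(card_imset _ fI); apply: subset_leq_card; apply/subsetP => Q /imsetP[[S X]].
rewrite inE /= => /andP[]; rewrite inE => /andP[_ /eqP cS] /cliquesP[cX kX] -> {Q}.
apply/cliquesP; split; last exact: clique_hjoin.
have -> : #|f (S, X)| = #|inl @: S : {set 'I_l + V}| + #|inr @: X : {set 'I_l + V}|.
  apply/eqP; rewrite (leq_card_setU _ _).2; apply/disjoint_notinP => _ /imsetP[a _ ->].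
  by apply/negP => /imsetP[].
by rewrite !card_imset ?cS ?cX // => a b [].
Qed.

(* Beyond the first l vertices, which are unrestricted, the edges are
   transversal to the colouring modulo x; for x = 0 no edge leaves the first l
   vertices (i %% 0 = i would make the colouring injective). *)
Definition multipartite_edges (p n l x : nat) : {set {set 'I_n}} :=
  [set e : {set 'I_n} | [&& #|e| == p, [forall u in e, (l <= u) ==> (0 < x)] &
    [forall u in e, forall v in e,
       [&& l <= u, l <= v & u != v] ==> ((u - l) %% x != (v - l) %% x)]]].

Lemma multipartite_uniform (p n l x : nat) : p_uniform p (multipartite_edges p n l x).
Proof. by apply/forall_inP => e; rewrite inE => /and3P[]. Qed.

Definition multipartite (p n l x : nat) : pgraph p 'I_n :=
  PGraph (multipartite_uniform p n l x).

Lemma multipartite_edgeP {p n l x : nat} {e : {set 'I_n}} :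
  reflect [/\ #|e| = p, forall u, u \in e -> l <= u -> 0 < x &
             forall u v, u \in e -> v \in e -> l <= u -> l <= v ->
               (u - l) %% x = (v - l) %% x -> u = v]
          (e \in hedges (multipartite p n l x)).
Proof.
rewrite inE; apply: (iffP and3P) => -[].
  move=> /eqP ce /forall_inP h1 /forall_inP h2; split=> // [u ue|u v ue ve lu lv uv].
    exact/implyP/h1.
  apply/eqP/negPn/negP => nuv; have /forall_inP/(_ v ve) := h2 u ue.
  by rewrite lu lv nuv uv eqxx.
move=> ce h1 h2; split; first exact/eqP.
  by apply/forall_inP => u ue; apply/implyP/h1.
apply/forall_inP => u ue; apply/forall_inP => v ve; apply/implyP => /and3P[lu lv].
by apply: contra => /eqP uv; apply/eqP/h2.
Qed.

(** As [2 <= p <= r], any two vertices of an [r]-clique lie in a common edge. So those beyond the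
    first [l] have distinct residues modulo [x] and number at most [x]; for [x = 0] there are
    none. *)
Lemma hfree_multipartite {p r t x n l : nat} :
  1 < p -> p <= r -> l < t * (r - x) ->
  hfree (disjoint_copies t (complete_pgraph p r)) (multipartite p n l x).
Proof.
move=> p1 pr hl; have r0 : 0 < r by apply: leq_trans pr; apply: ltnW.
apply: (@hfree_of_core _ _ _ x _ _ [set i : 'I_n | i < l]) => //.
  apply: leq_ltn_trans hl; rewrite cardE -(size_map val) -[l in _ <= l](size_iota 0).
  apply: uniq_leq_size; first by rewrite (map_inj_uniq val_inj) enum_uniq.
  by move=> v /mapP[i + ->]; rewrite mem_enum inE mem_iota.
move=> Q /cliquesP[cQ /cliqueP kQ].
have edge u v : u \in Q -> v \in Q -> exists e,
    [/\ e \in hedges (multipartite p n l x), u \in e & v \in e].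
  move=> uQ vQ; have [||e [se seQ ce]] := @exists_subset_between _ [set u; v] Q p.
  - by rewrite subUset !sub1set uQ.
  - by rewrite cQ pr andbT (leq_trans _ p1) // cards2; case: eqP.
  by exists e; split; [apply: kQ| |]; rewrite ?(subsetP se) // !inE eqxx ?orbT.
case: (posnP x) => [x0|x0].
  rewrite x0 leqn0 cards_eq0; apply/eqP/setP => v; rewrite !inE -leqNgt.
  apply/negP => /andP[lv vQ]; have [e [/multipartite_edgeP[_ h _] ve _]] := edge v v vQ vQ.
  by have := h v ve lv; rewrite x0.
rewrite -[x in _ <= x]card_ord.
apply: (leq_card_in (fun v : 'I_n => Ordinal (ltn_pmod (v - l) x0))).
move=> u v; rewrite !inE -!leqNgt => /andP[lu uQ] /andP[lv vQ] [uv].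
by have [e [/multipartite_edgeP[_ _ h] ue ve]] := edge u v uQ vQ; apply: h.
Qed.

(** The first [q] vertices are joined with one of [(n - l) %/ x] vertices from each residue class
    modulo [x]; the choice function [h] can be read off the clique. *)
Lemma card_cliques_multipartite {p n l q x : nat} :
  q <= l -> l <= n -> ((n - l) %/ x) ^ x <= #|cliques (q + x) (multipartite p n l x)|.
Proof.
move=> ql ln; set k := (n - l) %/ x.
have ltp (h : {ffun 'I_x -> 'I_k}) j : l + (h j * x + j) < n.
  have : h j * x + x <= k * x by rewrite -mulSnr leq_mul2r ltn_ord orbT.
  by have := leq_trunc_div (n - l) x; rewrite -/k; have := ltn_ord j; lia.
pose pt h j := Ordinal (ltp h j).
have ptl h j : l <= pt h j by rewrite leq_addr.
have ptm h j : (pt h j - l) %% x = j by rewrite /= addKn modnMDl modn_small.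
have qn : q <= n by apply: leq_trans ln.
pose Q0 := [set widen_ord qn i | i in [set: 'I_q]].
have Q0l i : i \in Q0 -> i < l.
  by move=> /imsetP[j _ ->] /=; apply: leq_trans ql.
have cQ0 : #|Q0| = q.
  by rewrite card_imset ?cardsT ?card_ord // => a b /(congr1 val) /= /val_inj.
pose Q h := Q0 :|: [set pt h j | j in [set: 'I_x]].
have QP h v : v \in Q h -> l <= v -> exists j, v = pt h j.
  rewrite inE => /orP[/Q0l|/imsetP[j _ ->]]; last by exists j.
  by rewrite ltnNge => /negbTE->.
have QI : injective Q.
  move=> h h' e; apply/ffunP => j.
  have : pt h j \in Q h' by rewrite -e inE imset_f ?orbT.
  move=> /QP-/(_ (ptl _ _))[j' ej]; have jj : j = j'.
    by apply: val_inj; rewrite /= -(ptm h j) -(ptm h' j') ej.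
  subst j'; move: ej => /(congr1 val) /= /eqP.
  rewrite eqn_add2l eqn_add2r eqn_pmul2r; first by move=> /eqP/val_inj.
  by apply: leq_ltn_trans (ltn_ord j).
have -> : k ^ x = #|[set Q h | h in [set: {ffun 'I_x -> 'I_k}]]|.
  by rewrite card_imset // cardsT card_ffun !card_ord.
apply: subset_leq_card; apply/subsetP => _ /imsetP[h _ ->].
apply/cliquesP; split.
  have -> : #|Q h| = #|Q0| + #|[set pt h j | j in [set: 'I_x]]|.
    apply/eqP; rewrite (leq_card_setU _ _).2; apply/disjoint_notinP => v /Q0l vl.
    by apply/negP => /imsetP[j _ ev]; move: vl; rewrite ev ltnNge ptl.
  rewrite cQ0 card_imset ?cardsT ?card_ord // => a b e.
  by apply: val_inj; rewrite /= -(ptm h a) -(ptm h b) e.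
apply/cliqueP => e /subsetP se ce; apply/multipartite_edgeP; split=> // [u /se uQ lu|u v].
  by have [j _] := QP h u uQ lu; apply: leq_ltn_trans (ltn_ord j).
move=> /se uQ /se vQ lu lv.
have [j ->] := QP h u uQ lu; have [j' ->] := QP h v vQ lv.
by rewrite !ptm => /val_inj ->.
Qed.

Lemma hex_geq_exp {p r s t q x n : nat} :
  1 < p -> p <= r -> q + x = s -> q < t * (r - x) -> t * (r - x) - 1 + x <= n ->
  n ^ x <= (t * (r - x) - 1 + 2 * x) ^ x
    * hex n (complete_pgraph p s) (disjoint_copies t (complete_pgraph p r)).
Proof.
move=> p1 pr qx hq hn; set l := _ - 1 in hn *.
have r0 : 0 < r by apply: leq_trans pr; apply: ltnW.
have lt : l < t * (r - x) by rewrite /l; lia.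
have := leq_ncopies_hex (s := s) (multipartite p n l x) r0 (card_ord n) (hfree_multipartite p1 pr lt).
rewrite ncopies_complete -qx => h.
have {}h : ((n - l) %/ x) ^ x <= _ := leq_trans (card_cliques_multipartite (q := q) _ _) h.
have {}h := h _ _; apply: leq_trans (leq_mul (leqnn _) (h _ _)); last first.
- by lia.
- by rewrite /l; lia.
case: (posnP x) => [->|x0]; first by rewrite !expn0.
rewrite -expnMn leq_exp2r //.
(* For [k = (n - l) %/ x >= 1] one has [n <= l + x * k + x <= (l + 2 * x) * k], which gives the
   constant. *)
have k1 : 0 < (n - l) %/ x by rewrite divn_gt0 //; lia.
have := ltn_ceil (n - l) x0; set k := _ %/ _ in k1 *; move=> hk.
have e1 : l <= l * k by rewrite leq_pmulr.
have e2 : x <= x * k by rewrite leq_pmulr.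
by rewrite mulnDl -mulnA; rewrite mulSn mulnC in hk; lia.
Qed.

(** * Asymptotics *)

(** With [k = r - x] and [q = s - x] the inequalities on [x] become [q < t * k] and
    [(k - 1) * t < q]. In the last claim, the room [bounded_core] needs in a kernel, lowering [j] by
    one lowers the left side by [t] until it is 0, so [j = q - 1] decides. *)
Lemma clique_parameters {r s t x : nat} :
  r <= s -> t.-1 * x + s < t * r -> t * r <= s + t.-1 * x.+1 ->
  [/\ x < r, (r - x).-1 * t < s - x, s - x < t * (r - x)
    & forall j, j < s - x -> t * (r - (s - j)) <= j].
Proof.
move=> rs h1 h2.
case: t h1 h2 => [|u] /=; first by rewrite ltn0.
move=> h1 h2.
have xr : x < r.
  rewrite ltnNge; apply/negP => rx.
  have : u * r <= u * x by rewrite leq_mul2l rx orbT.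
  by rewrite mulSn in h1; lia.
have [k ek] : exists k, r = x + k.+1 by exists (r - x).-1; lia.
have [q eq] : exists q, s = x + q by exists (s - x); lia.
subst r s; rewrite !addKn /=; split=> //; try by lia.
move=> j jq.
case: (leqP (x + k.+1) (x + q - j)) => h.
  by rewrite (eqP h) muln0.
have [d ed] : exists d, q = j + d.+1 by exists (q - j).-1; lia.
subst q; have -> : x + k.+1 - (x + (j + d.+1) - j) = k - d by lia.
have [c ec] : exists c, k = d + c by exists (k - d); lia.
by subst k; rewrite addKn; lia.
Qed.

Local Open Scope classical_set_scope.
Local Open Scope ring_scope.

(** The ceiling means [x < (tr - s) / (t - 1) <= x + 1], which is multiplied by [t - 1]. *)
Lemma ceil_parameters {r s t x : nat} :
  (r <= s)%N -> (s < t * r)%N ->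
  x%:Z = Num.ceil ((t%:Q * r%:Q - s%:Q) / (t%:Q - 1)) - 1 ->
  (t.-1 * x + s < t * r)%N /\ (t * r <= s + t.-1 * x.+1)%N.
Proof.
(* [t = 0] and [t = 1] contradict [r <= s < t * r], so the denominator is positive. *)
move=> rs; case: t => [|[|u]]; [by rewrite mul0n ltn0|by rewrite mul1n ltnNge rs|].
move=> st; set y := _ / _ => hx.
have u0 : 0 < u.+1%:Q by rewrite ltr0z.
have ey : y * u.+1%:Q = u.+2%:Q * r%:Q - s%:Q.
  rewrite /y (_ : u.+2%:Q - 1 = u.+1%:Q); last by rewrite -[u.+2]addn1 PoszD intrD addrK.
  by rewrite divfK // gt_eqF.
have /andP[] := real_ceil_itv (num_real y).
rewrite -hx (_ : Num.ceil y = x%:Z + 1); last by rewrite hx subrK.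
rewrite -(ltr_pM2r u0) -[in X in _ -> X](ler_pM2r u0) ey.
have eS m : m.+1%:Q = m%:Q + 1 by rewrite -[m.+1]addn1 PoszD intrD.
rewrite intrD !eS => h1 h2; split.
  by rewrite -ltz_nat -(ltr_int rat) !PoszD !PoszM !intrD !intrM /= ?eS; lra.
by rewrite -lez_nat -(ler_int rat) !PoszD !PoszM !intrD !intrM /= ?eS; lra.
Qed.

Lemma natr_eqO {R : realType} {f g : nat -> nat} (C N : nat) :
  (forall n, (N <= n)%N -> (f n <= C * g n)%N) ->
  (fun n => (f n)%:R : R) =O_\oo (fun n => (g n)%:R : R).
Proof.
move=> h; apply/eqO_exP; exists C.+1%:R; first by rewrite ltr0n.
exists N => // n /= Nn; rewrite !ger0_norm ?ler0n // -natrM ler_nat.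
by apply: leq_trans (h n Nn) _; rewrite leq_mul2r leqnSn orbT.
Qed.

(** The error [C * n ^ (x - 1)] is [o(n^x)] and [n ^ x] is [O(f)], so the difference is [o(f)]; this
    is why the equivalence is proved from [g] to [f]. *)
Lemma natr_equiv {R : realType} {f g : nat -> nat} {x : nat} (C D N : nat) :
  (0 < x)%N ->
  (forall n, (N <= n)%N -> (g n <= f n <= g n + C * n ^ x.-1)%N) ->
  (forall n, (N <= n)%N -> (n ^ x <= D * f n)%N) ->
  (fun n => (f n)%:R : R) ~_\oo (fun n => (g n)%:R : R).
Proof.
move=> x0 hgf hD; apply: equiv_sym; apply/eqaddoP => eps eps0.
near=> n.
have Nn : (N <= n)%N by near: n; exists N.
have /andP[gf fg] := hgf n Nn.
rewrite ![(_ - _) n]/(_ - _) /= distrC -natrB // !ger0_norm ?ler0n //.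
have h1 : ((f n - g n)%N%:R : R) <= C%:R * n%:R ^+ x.-1.
  by rewrite -natrX -natrM ler_nat leq_subLR.
have h2 : (n%:R : R) ^+ x <= D.+1%:R * (f n)%:R.
  rewrite -natrX -natrM ler_nat; apply: leq_trans (hD n Nn) _.
  by rewrite leq_mul2r leqnSn orbT.
(* This threshold gives [C * (D + 1) * n ^ (x - 1) <= eps * n ^ x]. *)
have h3 : (C * D.+1)%N%:R / eps <= (n%:R : R) by near: n; apply: nbhs_infty_ger.
have D0 : 0 < D.+1%:R :> R by rewrite ltr0n.
rewrite -(ler_pM2l D0); apply: le_trans (ler_wpM2l (ltW D0) h1) _.
rewrite [X in _ <= X]mulrCA; apply: le_trans (ler_wpM2l (ltW eps0) h2).
rewrite -[in X in _ <= X](prednK x0) exprS !mulrA.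
apply: ler_wpM2r; first by rewrite exprn_ge0.
by rewrite [_ * C%:R]mulrC -natrM [eps * _]mulrC -ler_pdivrMr.
Unshelve. all: by end_near. Qed.

Theorem theorem1p3 (R : realType) (p r s t x : nat)
    (hp : (2 <= p)%N) (hpr : (p <= r)%N)
    (ht : (1 <= t)%N) (hr : (2 <= r)%N) (hrs : (r <= s)%N) (hst : (s < t * r)%N)
    (hx : x%:Z = Num.ceil ((t%:Q * r%:Q - s%:Q) / (t%:Q - 1)) - 1) :
  let ex (n : nat) : R :=
    (hex n (complete_pgraph p s) (disjoint_copies t (complete_pgraph p r)))%:R in
  (forall T : forall n : nat, pgraph p 'I_(n - (t * (r - x) - 1)),
     (\forall n \near \oo,
        is_extremal (complete_pgraph p x) (complete_pgraph p x.+1) (T n)) ->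
     ex ~_\oo (fun n : nat =>
       (ncopies (complete_pgraph p s)
          (hjoin (complete_pgraph p (t * (r - x) - 1)) (T n)))%:R : R))
  /\ ex =Theta_\oo (fun n : nat => (n ^ x)%:R : R).
Proof.
have [h1 h2] := ceil_parameters hrs hst hx.
have [xr hq1 hq2 hc] := clique_parameters hrs h1 h2.
have p0 : (0 < p)%N by apply: ltnW.
have r0 : (0 < r)%N by apply: ltnW.
have k0 : (0 < r - x)%N by rewrite subn_gt0.
have kx : (r - x + x)%N = r by rewrite subnK // ltnW.
have qx : (s - x + x)%N = s by rewrite subnK // ltnW // (leq_trans xr).
have lt : (t * (r - x) - 1 < t * (r - x))%N.
  by rewrite subn1 prednK // (leq_ltn_trans _ hq2).
move=> ex; split; last first.
  rewrite eqThetaE bigThetaE; split; last rewrite eqOmegaO.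
    (* Outside the core a clique has [s - (s - x) = x] free vertices, whence [O(n^x)]. *)
    have [M hM] := bounded_core p r s t (s - x) r0 hc.
    apply: (natr_eqO (2 ^ M) 0) => n _; apply/bigmax_leqP => G Gf.
    have [A cA hA] := hM _ G Gf; rewrite ncopies_complete.
    apply: leq_trans (card_cliques_leq hA) _.
    rewrite card_ord subKn; last by rewrite -qx leq_addl.
    by rewrite leq_mul2r leq_exp2l // cA orbT.
  apply: (natr_eqO ((t * (r - x) - 1 + 2 * x) ^ x) (t * (r - x) - 1 + x)) => n.
  exact: hex_geq_exp hp hpr qx hq2.
move=> T [N _ hT].
(* Otherwise any [x + 1] vertices form a clique vacuously; the index is late enough for [T] to be
   extremal and to have [x + 1] vertices. *)
have px : (p <= x.+1)%N.
  rewrite leqNgt; apply/negP => xp.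
  have [|hf _] := hT (N + (t * (r - x) - 1) + x.+1)%N; first by rewrite /= -addnA leq_addr.
  move: hf; rewrite hfree_complete => /eqP/setP.
  have [|Y _ cY] := @exists_subset_card _ [set: 'I_(N + (t * (r - x) - 1) + x.+1 - (t * (r - x) - 1))] x.+1.
    by rewrite cardsT card_ord; lia.
  move=> /(_ Y); rewrite finset.in_set0 => /negP; apply; apply/cliquesP; split=> //.
  apply/cliqueP => e /subset_leq_card; rewrite cY => + ce.
  by rewrite ce leqNgt xp.
have x0 : (0 < x)%N by rewrite -ltnS (leq_trans hp).
have [C hC] := hex_leq_bin_mul p0 px x0 k0 kx qx hq1 hq2 hc.
(* The product of [C(l, q)] and the number of copies of [K_x] in [T] bounds the count in the join
   from below and, up to the error term, the extremal number from above. *)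
apply: (natr_equiv C ((t * (r - x) - 1 + 2 * x) ^ x) (N + (t * (r - x) - 1 + x)) x0) => n hn.
  have [Tf Tmax] := hT n (leq_trans (leq_addr _ _) hn).
  have ln : (t * (r - x) - 1 <= n)%N by lia.
  apply/andP; split.
    apply: leq_ncopies_hex => //; last exact: hfree_hjoin Tf.
    by rewrite card_sum !card_ord subnKC.
  apply: leq_trans (hC n _ ln Tmax) _; rewrite leq_add2r.
  exact: ncopies_hjoin_geq.
by apply: hex_geq_exp hp hpr qx hq2 _; lia.
Qed.
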